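(* Let $f:\mathbb{R}^d\to\mathbb{R}$ be continuously differentiable and bounded below by $f^*\in\mathbb{R}$, and let $L$ be a local first-order smoothness oracle (LFSO) for $f$. Let $0<\eta<2$ and let $(x_k)_{k\ge0}$, $(\widetilde{R}_k)_{k\ge0}$ be generated by Gradient Descent with LFSO from a starting point $x_0\in\mathbb{R}^d$ with stepsize factor $\eta$ and any choices $R_k>0$. Suppose that $f$ is $\mu$-PL for some $\mu>0$, that is, $f(x)-f^*\le\frac{1}{2\mu}\|\nabla f(x)\|^2$ for all $x\in\mathbb{R}^d$, and that $\sum_{k=0}^{\infty}\frac{1}{L(x_k,\widetilde{R}_k)}=\infty$. Then $\lim_{k\to\infty}f(x_k)=f^*$.
   Context: $\|\cdot\|$ is the Euclidean norm and $B(x,R)=\{y\in\mathbb{R}^d:\|y-x\|\le R\}$. For a continuously differentiable $f:\mathbb{R}^d\to\mathbb{R}$, a function $L:\mathbb{R}^d\times(0,\infty)\to[0,\infty)$ is a local first-order smoothness oracle (LFSO) for $f$ if (i) for all $x\in\mathbb{R}^d$, all $R>0$ and all $y\in B(x,R)$, $|f(y)-f(x)-\nabla f(x)^T(y-x)|\le \frac{L(x,R)}{2}\|y-x\|^2$; and (ii) $L$ is non-decreasing in $R$. Gradient Descent with LFSO: given $x_0\in\mathbb{R}^d$ and a stepsize factor $\eta>0$, for $k=0,1,2,\ldots$ choose any $R_k>0$, set $\widetilde{R}_k=\max\left\{R_k,\ \frac{\eta}{L(x_k,R_k)}\|\nabla f(x_k)\|\right\}$, and iterate $x_{k+1}=x_k-\frac{\eta}{L(x_k,\widetilde{R}_k)}\nabla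 f(x_k)$. It is understood that $L(x_k,R_k)>0$ for all $k$, so that the iteration is well defined. *)

(* Defs.v *)
From mathcomp Require Import all_boot all_order all_algebra.
From mathcomp Require Import all_classical all_reals all_analysis.

Set Implicit Arguments.
Unset Strict Implicit.
Unset Printing Implicit Defensive.

Import Order.TTheory GRing.Theory Num.Theory.
Import numFieldNormedType.Exports.

Local Open Scope classical_set_scope.
Local Open Scope ring_scope.

Definition dotmul (R : realType) (d : nat) (u v : 'rV[R]_d) : R :=
  \sum_i u 0 i * v 0 i.

(* The library norm `|u| on 'rV[R]_d is the sup norm; it induces the same
   topology, so continuity and differentiability are the usual ones, but
   metric quantities have to use the Euclidean norm. *)
Definition enorm (R : realType) (d : nat) (u : 'rV[R]_d) : R :=
  Num.sqrt (dotmul u u).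

Definition eball (R : realType) (d : nat) (x : 'rV[R]_d) (r : R) :
    set 'rV[R]_d :=
  [set y | enorm (y - x) <= r].

Definition gradient (R : realType) (d : nat) (f : 'rV[R]_d -> R)
    (x : 'rV[R]_d) : 'rV[R]_d :=
  \row_i 'D_(delta_mx 0 i) f x.

Definition continuously_differentiable (R : realType) (d : nat)
    (f : 'rV[R]_d -> R) : Prop :=
  (forall x, differentiable f x) /\ continuous (gradient f).

(* An oracle R^d * (0, +oo) -> [0, +oo) is represented by a total function;
   its values at nonpositive radii are irrelevant. *)
Definition LFSO (R : realType) (d : nat) (f : 'rV[R]_d -> R)
    (L : 'rV[R]_d -> R -> R) : Prop :=
  [/\ forall x r, 0 < r -> 0 <= L x r,
      forall x r y, 0 < r -> y \in eball x r ->
        `|f y - f x - dotmul (gradient f x) (y - x)|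
          <= L x r / 2 * enorm (y - x) ^+ 2
    & forall x r s, 0 < r -> r <= s -> L x r <= L x s].

(* [rad] and [trad] are the radii R_k and \widetilde{R}_k. *)
Definition gradient_descent_LFSO (R : realType) (d : nat)
    (f : 'rV[R]_d -> R) (L : 'rV[R]_d -> R -> R) (eta : R) (x0 : 'rV[R]_d)
    (rad trad : nat -> R) (x : nat -> 'rV[R]_d) : Prop :=
  x 0%N = x0 /\
  forall k,
    [/\ 0 < rad k,
        0 < L (x k) (rad k),
        trad k = Num.max (rad k)
                   (eta / L (x k) (rad k) * enorm (gradient f (x k)))
      & x k.+1 = x k - (eta / L (x k) (trad k)) *: gradient f (x k)].

Definition PL (R : realType) (d : nat) (f : 'rV[R]_d -> R) (fstar mu : R) :
    Prop :=
  forall x, f x - fstar <= 1 / (2 * mu) * enorm (gradient f x) ^+ 2.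

(* Main.v *)
Require Import Defs.
From mathcomp Require Import all_boot all_order all_algebra.
From mathcomp Require Import all_classical all_reals all_analysis.
From mathcomp Require Import ring lra.

(** The descent inequality and the PL condition give, for the gap
    [u k = f (x k) - fstar], [u k.+1 <= u k - w k * u k] with
    [w k = c / L (x k) (trad k)] and a constant [c > 0]. As [u] is nonincreasing,
    telescoping yields [(\sum_(k < n) w k) * u n <= u 0], and the series
    diverges. *)

Import Order.TTheory GRing.Theory Num.Theory.
Import numFieldNormedType.Exports.

Local Open Scope classical_set_scope.
Local Open Scope ring_scope.

Lemma dotmulZl (R : realType) (d : nat) (a : R) (u v : 'rV[R]_d) :
  dotmul (a *: u) v = a * dotmul u v.
Proof.
by rewrite /dotmul mulr_sumr; apply: eq_bigr => i _; rewrite mxE mulrA.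
Qed.

Lemma dotmulC (R : realType) (d : nat) (u v : 'rV[R]_d) :
  dotmul u v = dotmul v u.
Proof. by apply: eq_bigr => i _; rewrite mulrC. Qed.

Lemma dotmulZr (R : realType) (d : nat) (a : R) (u v : 'rV[R]_d) :
  dotmul u (a *: v) = a * dotmul u v.
Proof. by rewrite dotmulC dotmulZl dotmulC. Qed.

Lemma dotmul_ge0 (R : realType) (d : nat) (u : 'rV[R]_d) : 0 <= dotmul u u.
Proof. by apply: sumr_ge0 => i _; rewrite -expr2 sqr_ge0. Qed.

Lemma enorm_sqr (R : realType) (d : nat) (u : 'rV[R]_d) :
  enorm u ^+ 2 = dotmul u u.
Proof. by rewrite sqr_sqrtr ?dotmul_ge0. Qed.

Lemma enormZ (R : realType) (d : nat) (a : R) (u : 'rV[R]_d) :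
  enorm (a *: u) = `|a| * enorm u.
Proof.
by rewrite /enorm dotmulZl dotmulZr mulrA -expr2 sqrtrM ?sqr_ge0// sqrtr_sqr.
Qed.

(** If every partial sum were at most [M], so would be their limit, which is the value of the
    series. *)
Lemma nneseries_pinfty_unbounded {R : realType} {w : nat -> R} (M : R) :
  (forall k, 0 <= w k) -> (\sum_(0 <= k <oo) (w k)%:E = +oo)%E ->
  exists n, M < \sum_(0 <= k < n) w k.
Proof.
move=> w0 woo; apply: contrapT => /forallNP wM.
suff : (\sum_(0 <= k <oo) (w k)%:E <= M%:E)%E by rewrite woo leye_eq.
apply: lime_le; first by apply: is_cvg_nneseries => k _ _; rewrite lee_fin.
by apply: nearW => n; rewrite sumEFin lee_fin leNgt; apply/negP/wM.
Qed.

Lemma cvg0_of_proportional_decrease {R : realType} (c : R) (u w : nat -> R) :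
  0 < c -> (forall k, 0 <= u k) -> (forall k, 0 <= w k) ->
  (forall k, u k.+1 <= u k - c * w k * u k) ->
  (\sum_(0 <= k <oo) (w k)%:E = +oo)%E ->
  u @ \oo --> 0.
Proof.
move=> c0 u0 w0 uS woo.
have cwu_ge0 k m : 0 <= c * w k * u m by rewrite !mulr_ge0// ltW.
have u_noninc : nonincreasing_seq u.
  by apply/nonincreasing_seqP => k; apply: le_trans (uS k) _; rewrite gerBl.
have sum_bound n : c * (\sum_(0 <= k < n) w k) * u n <= u 0%N - u n.
  elim: n => [|n IH]; first by rewrite big_nil; lra.
  rewrite big_nat_recr//=.
  have un : u n.+1 <= u n by apply: u_noninc.
  have S0 : 0 <= \sum_(0 <= k < n) w k by apply: sumr_ge0.
  (* Monotonicity lets [u n] stand in for [u n.+1] beside the enlarged sum; the added term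
     [c * w n * u n] is then at most [u n - u n.+1], so the right-hand side telescopes. *)
  have : c * (\sum_(0 <= k < n) w k + w n) * u n.+1
      <= c * (\sum_(0 <= k < n) w k + w n) * u n.
    by rewrite ler_wpM2l// mulr_ge0 ?addr_ge0// ltW.
  have := uS n; lra.
apply/cvgrPdist_lt => e e0.
(* With this threshold [c * e] times the partial sum exceeds [u 0%N], so [e <= u N] would contradict
   [sum_bound N]; monotonicity covers all later indices. *)
have [N uN] := nneseries_pinfty_unbounded (u 0%N / (c * e)) w0 woo.
exists N => // n /= Nn; rewrite sub0r normrN ger0_norm//.
apply: le_lt_trans (u_noninc _ _ Nn) _; rewrite ltNge; apply/negP => eN.
have S0 : 0 <= \sum_(0 <= k < N) w k by apply: sumr_ge0.
move: uN; rewrite ltr_pdivrMr ?mulr_gt0// => uN.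
have : c * (\sum_(0 <= k < N) w k) * e <= c * (\sum_(0 <= k < N) w k) * u N.
  by rewrite ler_wpM2l// mulr_ge0// ltW.
have := sum_bound N; have := u0 N; lra.
Qed.

(** The bound on the step length puts the new point in the ball of radius [r], where the quadratic
    upper bound with constant [L x r] applies. *)
Lemma LFSO_descent (R : realType) (d : nat) (f : 'rV[R]_d -> R)
    (L : 'rV[R]_d -> R -> R) (x : 'rV[R]_d) (r eta : R) :
  LFSO f L -> 0 < r -> 0 < L x r -> 0 <= eta ->
  eta / L x r * enorm (gradient f x) <= r ->
  f (x - (eta / L x r) *: gradient f x)
    <= f x - eta * (1 - eta / 2) / L x r * enorm (gradient f x) ^+ 2.
Proof.
move=> [_ Lub _] r0 l0 eta0; move: (Lub x r) => {}Lub.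
set g := gradient f x in Lub *; set l := L x r in Lub l0 *.
move=> step_le.
have step_ge0 : 0 <= eta / l by rewrite divr_ge0// ltW.
set y := x - _.
have yx : y - x = (- (eta / l)) *: g by rewrite /y addrAC subrr sub0r scaleNr.
have normyx : enorm (y - x) = eta / l * enorm g.
  by rewrite yx enormZ normrN ger0_norm.
have : y \in eball x r by rewrite inE /eball/= normyx.
move=> /(Lub _ r0); rewrite normyx yx dotmulZr -enorm_sqr => /ler_normlW.
(* The term [eta / l * enorm g ^+ 2] cancels the first-order term of the expansion, leaving the
   claimed decrease. *)
suff -> : l / 2 * (eta / l * enorm g) ^+ 2
    = eta / l * enorm g ^+ 2 - eta * (1 - eta / 2) / l * enorm g ^+ 2 by lra.
by field; rewrite gt_eqF.
Qed.

(** The step size depends on the oracle at [trad k], yet the step must fit inside that radius. There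
    is no circularity: since [rad k <= trad k], the oracle value can only grow, so the step is no
    longer than the trial step computed with [rad k], and [trad k] dominates the latter by
    construction. *)
Lemma gradient_descent_LFSO_descent {R : realType} {d : nat}
    {f : 'rV[R]_d -> R} {L : 'rV[R]_d -> R -> R} {eta : R} {x0 : 'rV[R]_d}
    {rad trad : nat -> R} {x : nat -> 'rV[R]_d} (k : nat) :
  LFSO f L -> 0 <= eta -> gradient_descent_LFSO f L eta x0 rad trad x ->
  0 < L (x k) (trad k) /\
  f (x k.+1) <= f (x k) - eta * (1 - eta / 2) / L (x k) (trad k)
                          * enorm (gradient f (x k)) ^+ 2.
Proof.
move=> LL eta0 [_ /(_ k) [r0 l0 tradE ->]].
have rad_le : rad k <= trad k by rewrite tradE le_max lexx.
have L_le : L (x k) (rad k) <= L (x k) (trad k) by case: LL => _ _; apply.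
have lt0 : 0 < L (x k) (trad k) by apply: lt_le_trans L_le.
split => //; apply: LFSO_descent => //; first exact: lt_le_trans rad_le.
apply: (@le_trans _ _ (eta / L (x k) (rad k) * enorm (gradient f (x k)))).
  by rewrite ler_wpM2r ?sqrtr_ge0// ler_wpM2l// lef_pV2.
by rewrite [leRHS]tradE le_max lexx orbT.
Qed.

Theorem theorem3p6 (R : realType) (d : nat) (f : 'rV[R]_d -> R) (fstar : R)
    (L : 'rV[R]_d -> R -> R) (eta mu : R) (x0 : 'rV[R]_d)
    (rad trad : nat -> R) (x : nat -> 'rV[R]_d)
    (f_C1 : continuously_differentiable f)
    (f_bounded_below : forall y, fstar <= f y)
    (L_LFSO : LFSO f L)
    (eta_gt0 : 0 < eta) (eta_lt2 : eta < 2)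
    (x_GD : gradient_descent_LFSO f L eta x0 rad trad x)
    (mu_gt0 : 0 < mu)
    (f_PL : PL f fstar mu)
    (sum_infinite : (\sum_(0 <= k <oo) ((L (x k) (trad k))^-1)%:E = +oo)%E) :
  (fun k => f (x k)) @ \oo --> fstar.
Proof.
have descent k := gradient_descent_LFSO_descent k L_LFSO (ltW eta_gt0) x_GD.
have c_gt0 : 0 < eta * (1 - eta / 2) by rewrite mulr_gt0//; lra.
apply/subr_cvg0.
(* The factor [2 * mu] comes from the PL condition and [eta * (1 - eta / 2)] from the descent
   inequality. *)
apply: (cvg0_of_proportional_decrease (2 * mu * (eta * (1 - eta / 2))) _
    (fun k => (L (x k) (trad k))^-1)) => //=.
- by rewrite (mulr_gt0 _ c_gt0)// mulr_gt0.
- by move=> k; rewrite subr_ge0.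
- by move=> k; have [l0 _] := descent k; rewrite invr_ge0 ltW.
move=> k; have [l0 fS] := descent k.
have : 2 * mu * (f (x k) - fstar) <= enorm (gradient f (x k)) ^+ 2.
  by have := f_PL (x k); rewrite div1r mulrC ler_pdivlMr ?mulr_gt0// mulrC.
have cl0 : 0 <= eta * (1 - eta / 2) / L (x k) (trad k).
  by rewrite divr_ge0// ltW.
move=> /(ler_wpM2l cl0); lra.
Qed.
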